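(* Let $b_A(t),b_B(t)$ be arbitrary real functions and $z$ the deformation parameter. Consider on $(\mathbb{R}^2)^2$, with coordinates $(x_1,y_1,x_2,y_2)$ and symplectic form $\mathrm{d}x_1\wedge\mathrm{d}y_1+\mathrm{d}x_2\wedge\mathrm{d}y_2$, the $t$-dependent Hamiltonian $$h_z^{(2)}=b_A(t)\left(\left(\frac{\mathrm{e}^{zx_1}-1}{z}\right)\mathrm{e}^{zx_2}y_1+\left(\frac{\mathrm{e}^{zx_2}-1}{z}\right)y_2\right)-b_B(t)(x_1+x_2).$$ Its equations of motion are $$\frac{\mathrm{d}x_1}{\mathrm{d}t}=b_A(t)\left(\frac{\mathrm{e}^{zx_1}-1}{z}\right)\mathrm{e}^{zx_2},\qquad \frac{\mathrm{d}y_1}{\mathrm{d}t}=-b_A(t)\,\mathrm{e}^{z(x_1+x_2)}y_1+b_B(t),$$ $$\frac{\mathrm{d}x_2}{\mathrm{d}t}=b_A(t)\left(\frac{\mathrm{e}^{zx_2}-1}{z}\right),\qquad \frac{\mathrm{d}y_2}{\mathrm{d}t}=-b_A(t)\,\mathrm{e}^{zx_2}\bigl((\mathrm{e}^{zx_1}-1)y_1+y_2\bigr)+b_B(t).$$ The limit $z\to0$ leads to the undeformed, uncoupled system, but the deformed system does not consist of two copies of the one-dimensional deformed system $\dot x=b_A(t)\frac{\mathrm{e}^{zx}-1}{z}$, $\dot y=-b_A(t)\mathrm{e}^{zx}y+b_B(t)$; it has an additional nontrivial coupling of the variables. By means of the change of variables $x_k(t)=-\frac1z\ln u_k(t)$,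 $k=1,2$, the system is transformed into the linear system $$\frac{\mathrm{d}u_1}{\mathrm{d}t}=\frac{b_A(t)}{u_2}(u_1-1),\qquad \frac{\mathrm{d}y_1}{\mathrm{d}t}=-b_A(t)\frac{y_1}{u_1u_2}+b_B(t),$$ $$\frac{\mathrm{d}u_2}{\mathrm{d}t}=b_A(t)(u_2-1),\qquad \frac{\mathrm{d}y_2}{\mathrm{d}t}=\frac{b_A(t)}{u_2}\left(\frac{u_1-1}{u_1}\,y_1-y_2\right)+b_B(t),$$ which can again be solved by quadratures and no longer depends on the deformation parameter $z$.
   Context: The equations of motion are Hamilton's equations $\dot x_i=\partial h/\partial y_i$, $\dot y_i=-\partial h/\partial x_i$. The undeformed system consists of two copies of $\dot x=b_A(t)x$, $\dot y=-b_A(t)y+b_B(t)$. The word ''linear'' for the transformed system is the paper's own description of the displayed equations.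
   Formalization: The non-decoupling claim is stated at times with b_A(t)≠0 (for b_A=0 the system is two copies); solvability by quadratures is for continuous b_A, b_B (for arbitrary functions the integrals may not exist); ''linear'' is read as successively linear in the order u_2, u_1, y_1, y_2. *)

(* Defs.v *)
From Stdlib Require Import Reals.
From Coquelicot Require Import Coquelicot.
Open Scope R_scope.

(** A point of (R^2)^2 is [((x1, y1), (x2, y2))]; the product structure of
    Coquelicot makes it a normed module over R. *)
Definition plane : Type := (R * R)%type.
Definition phase : Type := (plane * plane)%type.

Definition interval (a b : Rbar) (t : R) : Prop := Rbar_lt a t /\ Rbar_lt t b.

(** [c] is an integral curve on the open interval (a, b) of the t-dependent
    vector field [F]. *)
Definition solves (F : R -> phase -> phase) (a b : Rbar) (c : R -> phase) : Prop :=
  forall t : R, interval a b t -> is_derive c t (F t (c t)).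

(** dx1 /\ dy1 + dx2 /\ dy2 *)
Definition omega (v w : phase) : R :=
  let '((v1, q1), (v2, q2)) := v in
  let '((w1, r1), (w2, r2)) := w in
  (v1 * r1 - q1 * w1) + (v2 * r2 - q2 * w2).

(** Right-hand side of x_i' = dh/dy_i, y_i' = - dh/dx_i. *)
Definition hamilton_field (h : phase -> R) (p : phase) : phase :=
  let '((x1, y1), (x2, y2)) := p in
  ((Derive (fun y => h ((x1, y), (x2, y2))) y1,
    - Derive (fun x => h ((x, y1), (x2, y2))) x1),
   (Derive (fun y => h ((x1, y1), (x2, y))) y2,
    - Derive (fun x => h ((x1, y1), (x, y2))) x2)).

Definition deformed_hamiltonian (bA bB : R -> R) (z t : R) (p : phase) : R :=
  let '((x1, y1), (x2, y2)) := p in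
  bA t * ((exp (z * x1) - 1) / z * exp (z * x2) * y1
          + (exp (z * x2) - 1) / z * y2)
  - bB t * (x1 + x2).

Definition deformed_field (bA bB : R -> R) (z t : R) (p : phase) : phase :=
  let '((x1, y1), (x2, y2)) := p in
  ((bA t * ((exp (z * x1) - 1) / z) * exp (z * x2),
    - bA t * exp (z * (x1 + x2)) * y1 + bB t),
   (bA t * ((exp (z * x2) - 1) / z),
    - bA t * exp (z * x2) * ((exp (z * x1) - 1) * y1 + y2) + bB t)).

Definition undeformed_field1 (bA bB : R -> R) (t : R) (p : plane) : plane :=
  let '(x, y) := p in (bA t * x, - bA t * y + bB t).

Definition deformed_field1 (bA bB : R -> R) (z t : R) (p : plane) : plane :=
  let '(x, y) := p in
  (bA t * ((exp (z * x) - 1) / z), - bA t * exp (z * x) * y + bB t).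

Definition two_copies (f : plane -> plane) (p : phase) : phase :=
  (f (fst p), f (snd p)).

Definition uncoupled (F : phase -> phase) : Prop :=
  exists f g : plane -> plane, forall p : phase, F p = (f (fst p), g (snd p)).

(** In the new variables a point is [((u1, y1), (u2, y2))], and the logarithms
    require u1, u2 > 0. *)
Definition u_positive (p : phase) : Prop :=
  let '((u1, _), (u2, _)) := p in 0 < u1 /\ 0 < u2.

Definition x_of_u (z : R) (p : phase) : phase :=
  let '((u1, y1), (u2, y2)) := p in
  ((- (1 / z) * ln u1, y1), (- (1 / z) * ln u2, y2)).

Definition transformed_field (bA bB : R -> R) (t : R) (p : phase) : phase :=
  let '((u1, y1), (u2, y2)) := p in
  ((bA t / u2 * (u1 - 1),
    - bA t * (y1 / (u1 * u2)) + bB t),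
   (bA t * (u2 - 1),
    bA t / u2 * ((u1 - 1) / u1 * y1 - y2) + bB t)).

(** [transformed_field] is not linear in (u1, y1, u2, y2) jointly.  It is
    linear successively, in the order u2, u1, y1, y2: each equation is an
    (inhomogeneous) linear equation for its own unknown, whose coefficients
    involve only t and the unknowns already determined. *)
Definition successively_linear (F : R -> phase -> phase) : Prop :=
  exists (k2 l2 : R -> R) (k1 l1 : R -> R -> R)
         (m1 n1 : R -> R -> R -> R) (m2 n2 : R -> R -> R -> R -> R),
  forall t u1 y1 u2 y2 : R, u_positive ((u1, y1), (u2, y2)) ->
    F t ((u1, y1), (u2, y2)) =
    ((k1 t u2 * u1 + l1 t u2,
      m1 t u2 u1 * y1 + n1 t u2 u1),
     (k2 t * u2 + l2 t,
      m2 t u2 u1 y1 * y2 + n2 t u2 u1 y1)).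

(** Formulas built from the coefficients bA(t), bB(t), the four initial values
    and constants by arithmetic, exponentials and quadratures. *)
Inductive quad : Type :=
  | QConst (r : R)
  | QbA
  | QbB
  | QInit (first_plane first_coord : bool)
  | QPlus (e f : quad)
  | QMult (e f : quad)
  | QInv (e : quad)
  | QExp (e : quad)
  | QInt (e : quad).

(** [QInt] is integration from the initial time [t0] to the current time; [p]
    is the point at time [t0]. *)
Fixpoint qeval (bA bB : R -> R) (t0 : R) (p : phase) (e : quad) (t : R) : R :=
  match e with
  | QConst r => r
  | QbA => bA t
  | QbB => bB t
  | QInit i j =>
      let q := if i then fst p else snd p in if j then fst q else snd q
  | QPlus e f => qeval bA bB t0 p e t + qeval bA bB t0 p f t
  | QMult e f => qeval bA bB t0 p e t * qeval bA bB t0 p f t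
  | QInv e => / qeval bA bB t0 p e t
  | QExp e => exp (qeval bA bB t0 p e t)
  | QInt e => RInt (qeval bA bB t0 p e) t0 t
  end.

(** [Rinv] and [RInt] are total, so meaningfulness of a formula on (a, b) has
    to be required separately: no division by zero, integrable integrands. *)
Fixpoint qdefined (bA bB : R -> R) (t0 : R) (p : phase) (a b : Rbar) (e : quad)
  : Prop :=
  match e with
  | QConst _ | QbA | QbB | QInit _ _ => True
  | QPlus e f | QMult e f =>
      qdefined bA bB t0 p a b e /\ qdefined bA bB t0 p a b f
  | QInv e =>
      qdefined bA bB t0 p a b e /\
      forall t, interval a b t -> qeval bA bB t0 p e t <> 0
  | QExp e => qdefined bA bB t0 p a b e
  | QInt e =>
      qdefined bA bB t0 p a b e /\
      forall t, interval a b t -> ex_RInt (qeval bA bB t0 p e) t0 t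
  end.

(** The general solution in the region [U] is given by formulas as above, the
    same for all coefficients, initial times and initial values.  Continuity of
    the coefficients is what gives the quadratures a meaning. *)
Definition solvable_by_quadratures
    (F : (R -> R) -> (R -> R) -> R -> phase -> phase) (U : phase -> Prop) : Prop :=
  exists e1 f1 e2 f2 : quad,
  forall (bA bB : R -> R) (a b : Rbar) (t0 : R),
    interval a b t0 ->
    (forall t, interval a b t -> continuous bA t /\ continuous bB t) ->
    let defined (a' b' : Rbar) (p : phase) :=
      qdefined bA bB t0 p a' b' e1 /\ qdefined bA bB t0 p a' b' f1 /\
      qdefined bA bB t0 p a' b' e2 /\ qdefined bA bB t0 p a' b' f2 in
    let formula (p : phase) (t : R) : phase :=
      ((qeval bA bB t0 p e1 t, qeval bA bB t0 p f1 t),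
       (qeval bA bB t0 p e2 t, qeval bA bB t0 p f2 t)) in
    (forall c : R -> phase,
       (forall t, interval a b t -> U (c t)) ->
       (solves (F bA bB) a b c <->
        defined a b (c t0) /\
        forall t, interval a b t -> c t = formula (c t0) t)) /\
    (forall p : phase, U p ->
       exists a' b' : Rbar,
         interval a' b' t0 /\ Rbar_le a a' /\ Rbar_le b' b /\
         defined a' b' p /\
         formula p t0 = p /\
         (forall t, interval a' b' t -> U (formula p t)) /\
         solves (F bA bB) a' b' (formula p)).

(* Main.v *)
Require Import Defs.
From Stdlib Require Import Reals Lra.
From Coquelicot Require Import Coquelicot.
Open Scope R_scope.

(** The equations of the transformed system are triangular: in the order
    u2, u1, y1, y2 each one is a scalar equation y' = k y + l whose coefficients
    are already known, so it has the unique solution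
    exp (int k) (y0 + int l exp (- int k)).  Only the two denominators u1 and u2
    limit the interval on which these formulas make sense, and both are positive
    near the initial time. *)

(** * Products of normed modules *)

Lemma is_derive_pair {U V : NormedModule R_AbsRing} (f : R -> U) (g : R -> V)
    (t : R) (l : U) (m : V) :
  is_derive f t l -> is_derive g t m ->
  is_derive (fun s => (f s, g s)) t (l, m).
Proof.
intros Hf Hg.
unfold is_derive.
apply filterdiff_ext_lin with (fun y : R => (scal y l, scal y m)).
2: reflexivity.
apply (filterdiff_comp'_2 f g (fun x y => (x, y))); try assumption.
apply filterdiff_linear, is_linear_prod.
- apply is_linear_fst.
- apply is_linear_snd.
Qed.

Lemma is_derive_fst {U V : NormedModule R_AbsRing} (f : R -> U * V) (t : R)
    (l : U * V) :
  is_derive f t l -> is_derive (fun s => fst (f s)) t (fst l).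
Proof.
intros Hf.
unfold is_derive.
apply filterdiff_ext_lin with (fun y : R => fst (scal y l)).
2: reflexivity.
apply (filterdiff_comp' f (fun p : U * V => fst p)); try assumption.
apply filterdiff_linear, is_linear_fst.
Qed.

Lemma is_derive_snd {U V : NormedModule R_AbsRing} (f : R -> U * V) (t : R)
    (l : U * V) :
  is_derive f t l -> is_derive (fun s => snd (f s)) t (snd l).
Proof.
intros Hf.
unfold is_derive.
apply filterdiff_ext_lin with (fun y : R => snd (scal y l)).
2: reflexivity.
apply (filterdiff_comp' f (fun p : U * V => snd p)); try assumption.
apply filterdiff_linear, is_linear_snd.
Qed.

(** Reduces every later claim about curves in phase space to four scalar derivatives, since pairing
    and both projections are linear. *)
Lemma is_derive_phase (c : R -> phase) (t : R) (v : phase) :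
  is_derive c t v <->
  (is_derive (fun s => fst (fst (c s))) t (fst (fst v)) /\
   is_derive (fun s => snd (fst (c s))) t (snd (fst v))) /\
  (is_derive (fun s => fst (snd (c s))) t (fst (snd v)) /\
   is_derive (fun s => snd (snd (c s))) t (snd (snd v))).
Proof.
split.
- intros H.
  pose proof (is_derive_fst _ _ _ H) as H1.
  pose proof (is_derive_snd _ _ _ H) as H2.
  split; split.
  + exact (is_derive_fst _ _ _ H1).
  + exact (is_derive_snd _ _ _ H1).
  + exact (is_derive_fst _ _ _ H2).
  + exact (is_derive_snd _ _ _ H2).
- intros [[H1 H2] [H3 H4]].
  pose proof (is_derive_pair _ _ _ _ _ (is_derive_pair _ _ _ _ _ H1 H2)
                (is_derive_pair _ _ _ _ _ H3 H4)) as H.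
  destruct v as [[v1 v2] [v3 v4]].
  refine (is_derive_ext _ _ _ _ _ H).
  intros s; now destruct (c s) as [[? ?] [? ?]].
Qed.

(** * Limits as the deformation parameter tends to 0 *)

Lemma filterlim_locally_pair {T : Type} {U V : UniformSpace}
    {F : (T -> Prop) -> Prop} {FF : Filter F} (f : T -> U) (g : T -> V)
    (a : U) (b : V) :
  filterlim f F (locally a) -> filterlim g F (locally b) ->
  filterlim (fun x => (f x, g x)) F (locally ((a, b) : U * V)).
Proof.
intros Hf Hg.
apply filterlim_locally; intros eps.
pose proof (proj1 (filterlim_locally _ _) Hf eps) as H1.
pose proof (proj1 (filterlim_locally _ _) Hg eps) as H2.
refine (filter_imp _ _ _ (filter_and _ _ H1 H2)).
intros x [Hx Hy]; now split.
Qed.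

Lemma filterlim_Rmult {T : Type} {F : (T -> Prop) -> Prop} {FF : Filter F}
    (f g : T -> R) (a b : R) :
  filterlim f F (locally a) -> filterlim g F (locally b) ->
  filterlim (fun x => f x * g x) F (locally (a * b)).
Proof.
intros Hf Hg.
exact (filterlim_comp_2 f g Rmult Hf Hg (filterlim_mult (K := R_AbsRing) a b)).
Qed.

(** Serves the entries of the field without a division by [z]: differentiability gives continuity at
    [a], and a limit along all points is also one along the points other than [a]. *)
Lemma filterlim_punctured (f : R -> R) (a l : R) :
  ex_derive f a -> f a = l -> filterlim f (locally' a) (locally l).
Proof.
intros Hf <-.
apply (filterlim_filter_le_1 (F := locally a) (G := locally' a)).
- intros P HP; unfold locally', within.
  revert HP; apply filter_imp; auto.
- exact (ex_derive_continuous f a Hf).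
Qed.

(** The expression is the difference quotient at 0 of [exp (z * x)] in [z], whose derivative there
    is [x]. *)
Lemma filterlim_expm1_div (x : R) :
  filterlim (fun z => (exp (z * x) - 1) / z) (locally' 0) (locally x).
Proof.
assert (H : derivable_pt_lim (fun z => exp (z * x)) 0 x).
{ apply is_derive_Reals; auto_derive; trivial.
  rewrite Rmult_0_l, exp_0; ring. }
apply filterlim_locally; intros eps.
destruct (H eps (cond_pos eps)) as [d Hd].
exists d; intros z Hz Hz0.
assert (Hzd : Rabs z < d).
{ revert Hz; unfold ball; simpl; unfold AbsRing_ball, abs, minus, plus, opp; simpl.
  now rewrite Ropp_0, Rplus_0_r. }
specialize (Hd z Hz0 Hzd).
now rewrite Rplus_0_l, Rmult_0_l, exp_0 in Hd.
Qed.

(** * The deformed Hamiltonian system *)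

Lemma deformed_field_limit (bA bB : R -> R) (t : R) (p : phase) :
  filterlim (fun z : R => deformed_field bA bB z t p) (locally' (0 : R))
    (locally (two_copies (undeformed_field1 bA bB t) p)).
Proof.
destruct p as [[x1 y1] [x2 y2]]; unfold two_copies; simpl.
assert (E : forall x, exp (0 * x) = 1) by (intros x; rewrite Rmult_0_l; apply exp_0).
apply filterlim_locally_pair; apply filterlim_locally_pair.
(* The added factor 1 is the limit of [exp (z * x2)]. *)
- replace (bA t * x1) with (bA t * x1 * 1) by ring.
  apply filterlim_Rmult; [apply filterlim_Rmult|].
  + apply filterlim_const.
  + apply filterlim_expm1_div.
  + apply filterlim_punctured; [now auto_derive | apply E].
- apply filterlim_punctured; [now auto_derive | rewrite E; ring].
- apply filterlim_Rmult.
  + apply filterlim_const.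
  + apply filterlim_expm1_div.
- apply filterlim_punctured; [now auto_derive | rewrite !E; ring].
Qed.

(** This and the next two rules specialise general differentiation rules to real-valued functions,
    so that the differential of the Hamiltonian can be assembled by unification. *)
Lemma filterdiff_Rmult {U : NormedModule R_AbsRing} (f g lf lg : U -> R) (x : U) :
  filterdiff f (locally x) lf -> filterdiff g (locally x) lg ->
  filterdiff (fun p => f p * g p) (locally x) (fun v => lf v * g x + f x * lg v).
Proof.
intros Hf Hg.
exact (filterdiff_mult_fct f g x lf lg Rmult_comm Hf Hg).
Qed.

Lemma filterdiff_Rplus {U : NormedModule R_AbsRing} (f g lf lg : U -> R) (x : U) :
  filterdiff f (locally x) lf -> filterdiff g (locally x) lg ->
  filterdiff (fun p => f p + g p) (locally x) (fun v => lf v + lg v).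
Proof.
intros Hf Hg.
exact (filterdiff_plus_fct f g lf lg Hf Hg).
Qed.

Lemma filterdiff_comp_derive {U : NormedModule R_AbsRing} (f : R -> R)
    (g lg : U -> R) (x : U) (l : R) :
  is_derive f (g x) l -> filterdiff g (locally x) lg ->
  filterdiff (fun p => f (g p)) (locally x) (fun v => lg v * l).
Proof.
intros Hf Hg.
exact (filterdiff_comp' g f x lg _ Hg Hf).
Qed.

(** Hamilton's equations in invariant form: contracting the symplectic form with the field gives the
    total differential of the Hamiltonian. *)
Lemma deformed_hamiltonian_filterdiff (bA bB : R -> R) (z t : R) (p : phase) :
  z <> 0 ->
  filterdiff (deformed_hamiltonian bA bB z t) (locally p)
    (omega (deformed_field bA bB z t p)).
Proof.
intros Hz.
assert (Hfst : forall q : phase, filterdiff (fun q : phase => fst q) (locally q)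
                 (fun v => fst v))
  by (intros q; apply filterdiff_linear, is_linear_fst).
assert (Hsnd : forall q : phase, filterdiff (fun q : phase => snd q) (locally q)
                 (fun v => snd v))
  by (intros q; apply filterdiff_linear, is_linear_snd).
assert (hfst : forall q : plane, filterdiff (fun q : plane => fst q) (locally q)
                 (fun v => fst v))
  by (intros q; apply filterdiff_linear, is_linear_fst).
assert (hsnd : forall q : plane, filterdiff (fun q : plane => snd q) (locally q)
                 (fun v => snd v))
  by (intros q; apply filterdiff_linear, is_linear_snd).
(* The differentials of the four coordinate functions on phase space. *)
pose proof (filterdiff_comp' _ _ p _ _ (Hfst p) (hfst (fst p))) as dx1.
pose proof (filterdiff_comp' _ _ p _ _ (Hfst p) (hsnd (fst p))) as dy1.
pose proof (filterdiff_comp' _ _ p _ _ (Hsnd p) (hfst (snd p))) as dx2.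
pose proof (filterdiff_comp' _ _ p _ _ (Hsnd p) (hsnd (snd p))) as dy2.
cbv beta in dx1, dy1, dx2, dy2.
assert (D1 : forall x, is_derive (fun x => (exp (z * x) - 1) / z) x (exp (z * x)))
  by (intros x; auto_derive; trivial; field; assumption).
assert (D2 : forall x, is_derive (fun x => exp (z * x)) x (z * exp (z * x)))
  by (intros x; auto_derive; trivial; ring).
assert (DA : forall x, is_derive (fun x => bA t * x) x (bA t))
  by (intros x; auto_derive; trivial; ring).
assert (DB : forall x, is_derive (fun x => - bB t * x) x (- bB t))
  by (intros x; auto_derive; trivial; ring).
(* The nesting follows the formula of the Hamiltonian: [bA t] times a sum of two products, plus
   [- bB t] times [x1 + x2]. *)
pose proof (filterdiff_Rplus _ _ _ _ _
  (filterdiff_comp_derive _ _ _ _ _ (DA _)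
    (filterdiff_Rplus _ _ _ _ _
      (filterdiff_Rmult _ _ _ _ _
        (filterdiff_Rmult _ _ _ _ _
          (filterdiff_comp_derive _ _ _ _ _ (D1 _) dx1)
          (filterdiff_comp_derive _ _ _ _ _ (D2 _) dx2))
        dy1)
      (filterdiff_Rmult _ _ _ _ _
        (filterdiff_comp_derive _ _ _ _ _ (D1 _) dx2) dy2)))
  (filterdiff_comp_derive _ _ _ _ _ (DB _)
    (filterdiff_Rplus _ _ _ _ _ dx1 dx2))) as H.
cbv beta in H.
refine (filterdiff_ext _ _ _ _ (filterdiff_ext_lin _ _ _ H _)).
- intros [[x1 y1] [x2 y2]]; simpl; ring.
- intros [[v1 w1] [v2 w2]]; destruct p as [[x1 y1] [x2 y2]]; simpl.
  rewrite Rmult_plus_distr_l, exp_plus; field; assumption.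
Qed.

Lemma hamilton_field_deformed (bA bB : R -> R) (z t : R) (p : phase) :
  z <> 0 ->
  hamilton_field (deformed_hamiltonian bA bB z t) p = deformed_field bA bB z t p.
Proof.
intros Hz; destruct p as [[x1 y1] [x2 y2]]; simpl.
f_equal; f_equal.
- apply is_derive_unique; auto_derive; trivial; field; assumption.
- apply Rminus_diag_uniq; unfold Rminus.
  (* The value supplied is the partial derivative in [x1], the negative of the entry of the
     field. *)
  rewrite (is_derive_unique _ _ (bA t * exp (z * (x1 + x2)) * y1 - bB t)).
  + ring.
  + rewrite Rmult_plus_distr_l, exp_plus; auto_derive; trivial; field; assumption.
- apply is_derive_unique; auto_derive; trivial; field; assumption.
- apply Rminus_diag_uniq; unfold Rminus.
  rewrite (is_derive_unique _ _
    (bA t * exp (z * x2) * ((exp (z * x1) - 1) * y1 + y2) - bB t)).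
  + ring.
  + auto_derive; trivial; field; assumption.
Qed.

(** * Coupling of the two planes *)

Lemma exp_mult_neq_1 (z x : R) : z <> 0 -> x <> 0 -> exp (z * x) <> 1.
Proof.
intros Hz Hx H.
apply (Rmult_integral_contrapositive_currified z x Hz Hx).
apply exp_inv; now rewrite exp_0.
Qed.

Lemma uncoupled_two_copies (f : plane -> plane) : uncoupled (two_copies f).
Proof. now exists f, f. Qed.

Lemma uncoupled_ext (F G : phase -> phase) :
  (forall p, F p = G p) -> uncoupled G -> uncoupled F.
Proof. intros H [f [g Hfg]]; exists f, g; intros p; now rewrite H. Qed.

(** In an uncoupled field the entry for [x1] ignores the second plane. Here, at [x1 = 1], moving
    [x2] from 0 to 1 multiplies that non-zero entry by [exp z], which is not 1. *)
Lemma deformed_field_coupled (bA bB : R -> R) (z t : R) :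
  z <> 0 -> bA t <> 0 -> ~ uncoupled (deformed_field bA bB z t).
Proof.
intros Hz HA [f [g H]].
pose proof (H ((1, 0), (0, 0))) as H0; pose proof (H ((1, 0), (1, 0))) as H1.
simpl in H0, H1.
apply (f_equal (fun p : phase => fst (fst p))) in H0.
apply (f_equal (fun p : phase => fst (fst p))) in H1.
simpl in H0, H1; rewrite <- H0 in H1; clear H0.
rewrite Rmult_0_r, exp_0 in H1.
apply (exp_mult_neq_1 z 1 Hz R1_neq_R0).
apply Rmult_eq_reg_l in H1; [exact H1|].
(* The cancelled factor [bA t * ((exp z - 1) / z)] has to be non-zero. *)
repeat apply Rmult_integral_contrapositive_currified; try assumption.
- intros E; apply (exp_mult_neq_1 z 1 Hz R1_neq_R0); lra.
- now apply Rinv_neq_0_compat.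
Qed.

(** * The logarithmic change of variables *)

Lemma x_of_u_bijective (z : R) (p : phase) :
  z <> 0 -> exists! q : phase, u_positive q /\ x_of_u z q = p.
Proof.
intros Hz; destruct p as [[x1 y1] [x2 y2]].
(* The inverse map is [u = exp (- z * x)] in each plane, with [y] unchanged. *)
exists ((exp (- z * x1), y1), (exp (- z * x2), y2)); split.
- split; [split; apply exp_pos|].
  assert (E : forall x, - (1 / z) * (- z * x) = x) by (intros x; field; assumption).
  simpl; now rewrite !ln_exp, !E.
- intros [[u1 v1] [u2 v2]] [[H1 H2] H]; simpl in H.
  injection H as E1 E2 E3 E4; subst.
  assert (E : forall u, 0 < u -> exp (- z * (- (1 / z) * ln u)) = u).
  { intros u Hu; replace (- z * (- (1 / z) * ln u)) with (ln u).
    - now apply exp_ln.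
    - field; assumption. }
  now rewrite !E.
Qed.

(** Both directions are the chain rule: one for the logarithm, the other for [u = exp (- z * x)], an
    identity that must hold in a neighbourhood of [t] and so uses positivity there. *)
Lemma is_derive_ln_scaled (z : R) (u : R -> R) (t l : R) :
  z <> 0 -> locally t (fun s => 0 < u s) ->
  is_derive (fun s => - (1 / z) * ln (u s)) t (- (1 / z) * (l / u t)) <->
  is_derive u t l.
Proof.
intros Hz Hloc.
pose proof (locally_singleton _ _ Hloc) as Ht; cbv beta in Ht.
split; intros H.
- apply is_derive_ext_loc with (fun s => exp (- z * (- (1 / z) * ln (u s)))).
  + revert Hloc; apply filter_imp; intros s Hs.
    replace (- z * (- (1 / z) * ln (u s))) with (ln (u s)) by (field; assumption).
    now apply exp_ln.
  + set (x := fun s => - (1 / z) * ln (u s)) in H |- *.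
    change (is_derive (fun s => exp (- z * x s)) t l).
    auto_derive.
    * now exists (- (1 / z) * (l / u t)).
    * replace (Derive (fun s => x s) t) with (- (1 / z) * (l / u t))
        by (symmetry; now apply is_derive_unique).
      replace (- z * x t) with (ln (u t)) by (unfold x; field; assumption).
      rewrite exp_ln by assumption; field; split; first [assumption | lra].
- auto_derive.
  + split; [now exists l | split; [assumption | trivial]].
  + replace (Derive (fun s => u s) t) with l
      by (symmetry; now apply is_derive_unique).
    field; split; first [assumption | lra].
Qed.

Lemma interval_locally (a b : Rbar) (t : R) :
  interval a b t -> locally t (interval a b).
Proof.
intros [Ha Hb].
apply filter_and.
- now apply open_Rbar_gt.
- now apply open_Rbar_lt.
Qed.

(** The equivalence already holds at each single time: the [y] coordinates are unchanged, the [u]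
    coordinates are handled by [is_derive_ln_scaled], and the two fields correspond under the change
    of variables. *)
Lemma change_of_variables (bA bB : R -> R) (z : R) (a b : Rbar) (c : R -> phase) :
  z <> 0 -> (forall t : R, interval a b t -> u_positive (c t)) ->
  (solves (deformed_field bA bB z) a b (fun t => x_of_u z (c t)) <->
   solves (transformed_field bA bB) a b c).
Proof.
intros Hz Hpos.
assert (Hpt : forall t, interval a b t ->
  is_derive (fun s => x_of_u z (c s)) t (deformed_field bA bB z t (x_of_u z (c t))) <->
  is_derive c t (transformed_field bA bB t (c t))).
{ intros t Ht.
  pose proof (interval_locally a b t Ht) as Hloc.
  assert (P1 : locally t (fun s => 0 < fst (fst (c s)))).
  { revert Hloc; apply filter_imp; intros s Hs; specialize (Hpos s Hs).
    destruct (c s) as [[? ?] [? ?]]; apply Hpos. }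
  assert (P2 : locally t (fun s => 0 < fst (snd (c s)))).
  { revert Hloc; apply filter_imp; intros s Hs; specialize (Hpos s Hs).
    destruct (c s) as [[? ?] [? ?]]; apply Hpos. }
  pose proof (locally_singleton _ _ P1) as Q1; cbv beta in Q1.
  pose proof (locally_singleton _ _ P2) as Q2; cbv beta in Q2.
  rewrite !is_derive_phase.
  rewrite <- (is_derive_ln_scaled z _ t _ Hz P1), <- (is_derive_ln_scaled z _ t _ Hz P2).
  assert (X1 : forall s, fst (fst (x_of_u z (c s))) = - (1 / z) * ln (fst (fst (c s))))
    by (intros s; now destruct (c s) as [[? ?] [? ?]]).
  assert (X2 : forall s, fst (snd (x_of_u z (c s))) = - (1 / z) * ln (fst (snd (c s))))
    by (intros s; now destruct (c s) as [[? ?] [? ?]]).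
  assert (Y1 : forall s, snd (fst (x_of_u z (c s))) = snd (fst (c s)))
    by (intros s; now destruct (c s) as [[? ?] [? ?]]).
  assert (Y2 : forall s, snd (snd (x_of_u z (c s))) = snd (snd (c s)))
    by (intros s; now destruct (c s) as [[? ?] [? ?]]).
  assert (E : forall (f g : R -> R) l m, (forall s, f s = g s) -> l = m ->
    (is_derive f t l <-> is_derive g t m)).
  { intros f g l m Hfg ->; split; apply is_derive_ext; intros s; now rewrite Hfg. }
  rewrite (E _ _ _ _ X1 eq_refl), (E _ _ _ _ X2 eq_refl), (E _ _ _ _ Y1 eq_refl),
    (E _ _ _ _ Y2 eq_refl).
  clear X1 X2 Y1 Y2 P1 P2.
  (* Each [exp (z * x)] turns into [/ u]; this is how [z] disappears from the equations. *)
  assert (L : forall u, 0 < u -> exp (z * (- (1 / z) * ln u)) = / u).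
  { intros u Hu; replace (z * (- (1 / z) * ln u)) with (- ln u) by (field; assumption).
    now rewrite exp_Ropp, exp_ln. }
  (* The deformed field at the image point is the push-forward of the transformed field. *)
  assert (V : let v := deformed_field bA bB z t (x_of_u z (c t)) in
              let w := transformed_field bA bB t (c t) in
    v = ((- (1 / z) * (fst (fst w) / fst (fst (c t))), snd (fst w)),
         (- (1 / z) * (fst (snd w) / fst (snd (c t))), snd (snd w)))).
  { destruct (c t) as [[u1 y1] [u2 y2]]; simpl in Q1, Q2 |- *.
    rewrite Rmult_plus_distr_l, exp_plus, !L by assumption.
    f_equal; f_equal; field; repeat split; lra. }
  cbv zeta in V; rewrite V; simpl; tauto. }
split; intros H t Ht; apply (Hpt t Ht), (H t Ht).
Qed.

Lemma transformed_successively_linear (bA bB : R -> R) :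
  successively_linear (transformed_field bA bB).
Proof.
exists bA, (fun t => - bA t), (fun t u2 => bA t / u2), (fun t u2 => - (bA t / u2)),
  (fun t u2 u1 => - bA t / (u1 * u2)), (fun t _ _ => bB t),
  (fun t u2 _ _ => - (bA t / u2)),
  (fun t u2 u1 y1 => bA t / u2 * ((u1 - 1) / u1 * y1) + bB t).
intros t u1 y1 u2 y2 [H1 H2]; simpl.
f_equal; f_equal; field; lra.
Qed.

(** * Scalar linear equations on an interval *)

(** Convexity of the interval, phrased with [Rmin] and [Rmax] because integrals from [t0] to [t] run
    in either direction. *)
Lemma interval_between (a b : Rbar) (t0 t s : R) :
  interval a b t0 -> interval a b t -> Rmin t0 t <= s <= Rmax t0 t ->
  interval a b s.
Proof.
intros [H1 H2] [H3 H4] [H5 H6]; split.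
- apply Rbar_lt_le_trans with (Rmin t0 t); [|exact H5].
  unfold Rmin; now destruct (Rle_dec t0 t).
- apply Rbar_le_lt_trans with (Rmax t0 t); [exact H6|].
  unfold Rmax; now destruct (Rle_dec t0 t).
Qed.

Definition continuous_on (a b : Rbar) (f : R -> R) : Prop :=
  forall t, interval a b t -> continuous f t.

Lemma continuous_on_ex_RInt (a b : Rbar) (f : R -> R) (t0 t : R) :
  continuous_on a b f -> interval a b t0 -> interval a b t -> ex_RInt f t0 t.
Proof.
intros Hf H0 Ht; apply (ex_RInt_continuous (V := R_CompleteNormedModule)).
intros s Hs; apply Hf, (interval_between a b t0 t s H0 Ht Hs).
Qed.

Lemma is_derive_RInt_on (a b : Rbar) (f : R -> R) (t0 t : R) :
  continuous_on a b f -> interval a b t0 -> interval a b t ->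
  is_derive (RInt f t0) t (f t).
Proof.
intros Hf H0 Ht; apply is_derive_RInt with t0; [|now apply Hf].
refine (filter_imp _ _ _ (interval_locally a b t Ht)); intros s Hs.
apply (RInt_correct (V := R_CompleteNormedModule)).
now apply (continuous_on_ex_RInt a b).
Qed.

Lemma derive_zero_constant_on (a b : Rbar) (f : R -> R) (t0 t : R) :
  (forall s, interval a b s -> is_derive f s 0) ->
  interval a b t0 -> interval a b t -> f t = f t0.
Proof.
intros Hf H0 Ht.
assert (K : forall r s, interval a b r -> interval a b s -> r < s -> f r = f s).
{ intros r s Hr Hs Hrs; apply (eq_is_derive f r s); [|exact Hrs].
  intros x Hx; apply Hf, (interval_between a b r s x Hr Hs).
  now rewrite Rmin_left, Rmax_right by lra. }
destruct (Rtotal_order t t0) as [H|[->|H]]; auto.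
symmetry; auto.
Qed.

(** The difference of the solutions times the integrating factor [exp (- RInt k t0 s)] has
    derivative 0 and vanishes at [t0], while the factor itself never vanishes. *)
Lemma linear_ode_unique (a b : Rbar) (k l f g : R -> R) (t0 : R) :
  continuous_on a b k -> interval a b t0 ->
  (forall t, interval a b t -> is_derive f t (k t * f t + l t)) ->
  (forall t, interval a b t -> is_derive g t (k t * g t + l t)) ->
  f t0 = g t0 -> forall t, interval a b t -> f t = g t.
Proof.
intros Hk H0 Hf Hg E0 t Ht.
set (h := fun s => (f s - g s) * exp (- RInt k t0 s)).
assert (Hh : h t = h t0).
{ apply (derive_zero_constant_on a b); try assumption.
  intros s Hs.
  pose proof (is_derive_RInt_on a b k t0 s Hk H0 Hs) as HI.
  specialize (Hf s Hs); specialize (Hg s Hs).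
  (* The integral is hidden behind a name so that [auto_derive] treats it as a function whose
     derivative is given by [HI]. *)
  set (K := RInt k t0) in HI.
  change (is_derive (fun s => (f s - g s) * exp (- K s)) s 0).
  auto_derive.
  - repeat split; [now exists (k s * f s + l s) | now exists (k s * g s + l s)
      | now exists (k s)].
  - replace (Derive (fun x => f x) s) with (k s * f s + l s)
      by (symmetry; now apply is_derive_unique).
    replace (Derive (fun x => g x) s) with (k s * g s + l s)
      by (symmetry; now apply is_derive_unique).
    replace (Derive (fun x => K x) s) with (k s)
      by (symmetry; now apply is_derive_unique).
    ring. }
unfold h in Hh; rewrite E0, Rminus_diag, Rmult_0_l in Hh.
apply Rmult_integral in Hh; pose proof (exp_pos (- RInt k t0 t)); lra.
Qed.

(** * Quadratures *)

(** By induction on the formula: [qdefined] keeps denominators away from 0, and the integral of a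
    continuous integrand is differentiable. *)
Lemma qeval_continuous_on (bA bB : R -> R) (t0 : R) (p : phase) (a b : Rbar)
    (e : quad) :
  continuous_on a b bA -> continuous_on a b bB -> interval a b t0 ->
  qdefined bA bB t0 p a b e -> continuous_on a b (qeval bA bB t0 p e).
Proof.
intros HA HB H0; induction e; simpl; intros Hd t Ht.
- apply continuous_const.
- now apply HA.
- now apply HB.
- apply continuous_const.
- destruct Hd; apply (continuous_plus (V := R_NormedModule));
    [now apply IHe1 | now apply IHe2].
- destruct Hd; apply (continuous_mult (K := R_AbsRing));
    [now apply IHe1 | now apply IHe2].
- destruct Hd as [Hd Hn]; apply continuous_Rinv_comp; [now apply IHe | now apply Hn].
- now apply continuous_exp_comp, IHe.
- destruct Hd as [Hd _].
  apply (ex_derive_continuous (V := R_NormedModule)).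
  exists (qeval bA bB t0 p e t); apply (is_derive_RInt_on a b); auto.
Qed.

Definition QOpp (e : quad) : quad := QMult (QConst (-1)) e.

(** Variation of constants for y' = k y + l, y(t0) = y0. *)
Definition QLin (k l y0 : quad) : quad :=
  QMult (QExp (QInt k)) (QPlus y0 (QInt (QMult l (QExp (QOpp (QInt k)))))).

(** All integrals run from [t0] to [t0] and vanish. *)
Lemma qeval_QLin_init (bA bB : R -> R) (t0 : R) (p : phase) (k l y0 : quad) :
  qeval bA bB t0 p (QLin k l y0) t0 = qeval bA bB t0 p y0 t0.
Proof.
simpl; rewrite !(RInt_point (V := R_CompleteNormedModule)).
unfold zero; simpl; rewrite exp_0; ring.
Qed.

Lemma qdefined_QInt (bA bB : R -> R) (t0 : R) (p : phase) (a b : Rbar) (e : quad) :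
  continuous_on a b bA -> continuous_on a b bB -> interval a b t0 ->
  qdefined bA bB t0 p a b e -> qdefined bA bB t0 p a b (QInt e).
Proof.
intros HA HB H0 He; split; [exact He|].
intros t Ht; apply (continuous_on_ex_RInt a b); try assumption.
now apply qeval_continuous_on.
Qed.

Lemma qdefined_QLin (bA bB : R -> R) (t0 : R) (p : phase) (a b : Rbar)
    (k l y0 : quad) :
  continuous_on a b bA -> continuous_on a b bB -> interval a b t0 ->
  qdefined bA bB t0 p a b k -> qdefined bA bB t0 p a b l ->
  qdefined bA bB t0 p a b y0 -> qdefined bA bB t0 p a b (QLin k l y0).
Proof.
intros HA HB H0 Hk Hl Hy.
pose proof (qdefined_QInt bA bB t0 p a b k HA HB H0 Hk) as HK.
split; [exact HK | split; [exact Hy|]].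
apply qdefined_QInt; try assumption.
split; [exact Hl | exact (conj I HK)].
Qed.

(** The product rule gives [k] times the formula plus [exp K] times [l * exp (- K)], where the
    exponentials cancel. The initial value is a [QInit] formula, hence constant in time. *)
Lemma is_derive_QLin (bA bB : R -> R) (t0 : R) (p : phase) (a b : Rbar)
    (k l : quad) (i j : bool) (t : R) :
  continuous_on a b bA -> continuous_on a b bB -> interval a b t0 ->
  qdefined bA bB t0 p a b k -> qdefined bA bB t0 p a b l -> interval a b t ->
  is_derive (qeval bA bB t0 p (QLin k l (QInit i j))) t
    (qeval bA bB t0 p k t * qeval bA bB t0 p (QLin k l (QInit i j)) t
     + qeval bA bB t0 p l t).
Proof.
intros HA HB H0 Hk Hl Ht.
pose proof (qdefined_QInt bA bB t0 p a b k HA HB H0 Hk) as HK.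
assert (Hm : qdefined bA bB t0 p a b (QMult l (QExp (QOpp (QInt k)))))
  by (split; [exact Hl | exact (conj I HK)]).
pose proof (is_derive_RInt_on a b _ t0 t
  (qeval_continuous_on bA bB t0 p a b k HA HB H0 Hk) H0 Ht) as D1.
pose proof (is_derive_RInt_on a b _ t0 t
  (qeval_continuous_on bA bB t0 p a b _ HA HB H0 Hm) H0 Ht) as D2.
set (kv := qeval bA bB t0 p k) in *.
set (mv := qeval bA bB t0 p (QMult l (QExp (QOpp (QInt k))))) in *.
set (y0 := qeval bA bB t0 p (QInit i j) t).
assert (Em : mv t = qeval bA bB t0 p l t * exp (- RInt kv t0 t)).
{ unfold mv; simpl; f_equal; f_equal; unfold kv; ring. }
set (K := RInt kv t0) in *; set (M := RInt mv t0) in *.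
change (is_derive (fun s => exp (K s) * (y0 + M s)) t
  (kv t * (exp (K t) * (y0 + M t)) + qeval bA bB t0 p l t)).
auto_derive.
- repeat split; [now exists (kv t) | now exists (mv t)].
- replace (Derive (fun x => K x) t) with (kv t)
    by (symmetry; now apply is_derive_unique).
  replace (Derive (fun x => M x) t) with (mv t)
    by (symmetry; now apply is_derive_unique).
  rewrite Em, exp_Ropp; field; apply Rgt_not_eq, exp_pos.
Qed.

(** * Explicit solution formulas for the transformed system *)

Definition quad_u2 : quad := QLin QbA (QOpp QbA) (QInit false true).
(** With [k1 = bA / u2] the other equations read [u1' = k1 u1 - k1], [y1' = m1 y1 + bB] and
    [y2' = - k1 y2 + n2]. *)
Definition quad_k1 : quad := QMult QbA (QInv quad_u2).
Definition quad_u1 : quad := QLin quad_k1 (QOpp quad_k1) (QInit true true).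
Definition quad_m1 : quad := QOpp (QMult quad_k1 (QInv quad_u1)).
Definition quad_y1 : quad := QLin quad_m1 QbB (QInit true false).
Definition quad_n2 : quad :=
  QPlus (QMult quad_k1
    (QMult (QMult (QPlus quad_u1 (QConst (-1))) (QInv quad_u1)) quad_y1)) QbB.
Definition quad_y2 : quad := QLin (QOpp quad_k1) quad_n2 (QInit false false).

Definition quad_solution (bA bB : R -> R) (t0 : R) (p : phase) (t : R) : phase :=
  ((qeval bA bB t0 p quad_u1 t, qeval bA bB t0 p quad_y1 t),
   (qeval bA bB t0 p quad_u2 t, qeval bA bB t0 p quad_y2 t)).

Lemma quad_solution_init (bA bB : R -> R) (t0 : R) (p : phase) :
  quad_solution bA bB t0 p t0 = p.
Proof.
unfold quad_solution, quad_u1, quad_u2, quad_y1, quad_y2.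
rewrite !qeval_QLin_init; now destruct p as [[? ?] [? ?]].
Qed.

Lemma qdefined_u2 (bA bB : R -> R) (t0 : R) (p : phase) (a b : Rbar) :
  continuous_on a b bA -> continuous_on a b bB -> interval a b t0 ->
  qdefined bA bB t0 p a b quad_u2.
Proof. intros HA HB H0; now apply qdefined_QLin. Qed.

(** Division by [u2] enters here; the formula for [u2] itself is defined on the whole interval. *)
Lemma qdefined_k1 (bA bB : R -> R) (t0 : R) (p : phase) (a b : Rbar) :
  continuous_on a b bA -> continuous_on a b bB -> interval a b t0 ->
  (forall t, interval a b t -> 0 < qeval bA bB t0 p quad_u2 t) ->
  qdefined bA bB t0 p a b quad_k1.
Proof.
intros HA HB H0 H2; split; [exact I|split].
- now apply qdefined_u2.
- intros t Ht; now apply Rgt_not_eq, H2.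
Qed.

Lemma qdefined_u1 (bA bB : R -> R) (t0 : R) (p : phase) (a b : Rbar) :
  continuous_on a b bA -> continuous_on a b bB -> interval a b t0 ->
  (forall t, interval a b t -> 0 < qeval bA bB t0 p quad_u2 t) ->
  qdefined bA bB t0 p a b quad_u1.
Proof.
intros HA HB H0 H2.
pose proof (qdefined_k1 bA bB t0 p a b HA HB H0 H2) as K1.
now apply qdefined_QLin; try assumption; split.
Qed.

Definition quad_solution_defined (bA bB : R -> R) (t0 : R) (p : phase)
    (a b : Rbar) : Prop :=
  qdefined bA bB t0 p a b quad_u1 /\ qdefined bA bB t0 p a b quad_y1 /\
  qdefined bA bB t0 p a b quad_u2 /\ qdefined bA bB t0 p a b quad_y2.

(** Definedness propagates in the order u2, k1, u1, m1, y1, n2, y2, with positivity of u2 and u1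
    justifying the inversions. *)
Lemma qdefined_coefficients (bA bB : R -> R) (t0 : R) (p : phase) (a b : Rbar) :
  continuous_on a b bA -> continuous_on a b bB -> interval a b t0 ->
  (forall t, interval a b t -> u_positive (quad_solution bA bB t0 p t)) ->
  quad_solution_defined bA bB t0 p a b /\
  qdefined bA bB t0 p a b quad_k1 /\
  qdefined bA bB t0 p a b quad_m1 /\
  qdefined bA bB t0 p a b quad_n2.
Proof.
intros HA HB H0 Hpos.
assert (H2 : forall t, interval a b t -> 0 < qeval bA bB t0 p quad_u2 t)
  by (intros t Ht; apply (Hpos t Ht)).
assert (H1 : forall t, interval a b t -> qeval bA bB t0 p quad_u1 t <> 0)
  by (intros t Ht; apply Rgt_not_eq, (Hpos t Ht)).
pose proof (qdefined_u2 bA bB t0 p a b HA HB H0) as U2.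
pose proof (qdefined_k1 bA bB t0 p a b HA HB H0 H2) as K1.
pose proof (qdefined_u1 bA bB t0 p a b HA HB H0 H2) as U1.
assert (M1 : qdefined bA bB t0 p a b quad_m1)
  by exact (conj I (conj K1 (conj U1 H1))).
assert (Y1 : qdefined bA bB t0 p a b quad_y1)
  by (now apply qdefined_QLin; try exact I).
assert (N2 : qdefined bA bB t0 p a b quad_n2)
  by exact (conj (conj K1 (conj (conj (conj U1 I) (conj U1 H1)) Y1)) I).
assert (Y2 : qdefined bA bB t0 p a b quad_y2)
  by (apply qdefined_QLin; try assumption; [exact (conj I K1) | exact I]).
unfold quad_solution_defined; tauto.
Qed.

Lemma quad_solution_solves (bA bB : R -> R) (t0 : R) (p : phase) (a b : Rbar) :
  continuous_on a b bA -> continuous_on a b bB -> interval a b t0 ->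
  (forall t, interval a b t -> u_positive (quad_solution bA bB t0 p t)) ->
  solves (transformed_field bA bB) a b (quad_solution bA bB t0 p).
Proof.
intros HA HB H0 Hpos t Ht.
destruct (qdefined_coefficients bA bB t0 p a b HA HB H0 Hpos)
  as [_ [K1 [M1 N2]]].
assert (E : forall (f : R -> R) (l m : R), is_derive f t l -> l = m -> is_derive f t m)
  by (intros; now subst).
specialize (Hpos t Ht); destruct Hpos as [P1 P2].
apply is_derive_phase; split; split.
- refine (E _ _ _ (is_derive_QLin bA bB t0 p a b quad_k1 (QOpp quad_k1) true true t
    HA HB H0 K1 (conj I K1) Ht) _).
  (* Only the coefficients are unfolded; the solution formulas stay folded so that [field] sees them
     as atoms. *)
  change (qeval bA bB t0 p quad_k1 t)
    with (bA t * / qeval bA bB t0 p quad_u2 t).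
  change (qeval bA bB t0 p (QOpp quad_k1) t)
    with (-1 * (bA t * / qeval bA bB t0 p quad_u2 t)).
  fold quad_u1; cbv [quad_solution transformed_field fst snd].
  field; lra.
- refine (E _ _ _ (is_derive_QLin bA bB t0 p a b quad_m1 QbB true false t
    HA HB H0 M1 I Ht) _).
  change (qeval bA bB t0 p quad_m1 t)
    with (-1 * (bA t * / qeval bA bB t0 p quad_u2 t * / qeval bA bB t0 p quad_u1 t)).
  change (qeval bA bB t0 p QbB t) with (bB t).
  fold quad_y1; cbv [quad_solution transformed_field fst snd].
  field; lra.
- refine (E _ _ _ (is_derive_QLin bA bB t0 p a b QbA (QOpp QbA) false true t
    HA HB H0 I (conj I I) Ht) _).
  change (qeval bA bB t0 p QbA t) with (bA t).
  change (qeval bA bB t0 p (QOpp QbA) t) with (-1 * bA t).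
  fold quad_u2; cbv [quad_solution transformed_field fst snd].
  ring.
- refine (E _ _ _ (is_derive_QLin bA bB t0 p a b (QOpp quad_k1) quad_n2 false false t
    HA HB H0 (conj I K1) N2 Ht) _).
  change (qeval bA bB t0 p (QOpp quad_k1) t)
    with (-1 * (bA t * / qeval bA bB t0 p quad_u2 t)).
  change (qeval bA bB t0 p quad_n2 t)
    with (bA t * / qeval bA bB t0 p quad_u2 t
      * ((qeval bA bB t0 p quad_u1 t + -1) * / qeval bA bB t0 p quad_u1 t
         * qeval bA bB t0 p quad_y1 t) + bB t).
  fold quad_y2; cbv [quad_solution transformed_field fst snd].
  field; lra.
Qed.

(** Scalar uniqueness is applied in the order u2, u1, y1, y2. Once a coordinate is identified with
    its formula, the coefficients of the next equation are given by formulas too. *)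
Lemma solves_eq_quad_solution (bA bB : R -> R) (t0 : R) (a b : Rbar)
    (c : R -> phase) :
  continuous_on a b bA -> continuous_on a b bB -> interval a b t0 ->
  (forall t, interval a b t -> u_positive (c t)) ->
  solves (transformed_field bA bB) a b c ->
  forall t, interval a b t -> c t = quad_solution bA bB t0 (c t0) t.
Proof.
intros HA HB H0 Hpos Hc.
set (p := c t0).
set (u1 := fun t => fst (fst (c t))); set (y1 := fun t => snd (fst (c t))).
set (u2 := fun t => fst (snd (c t))); set (y2 := fun t => snd (snd (c t))).
assert (Ec : forall t, c t = ((u1 t, y1 t), (u2 t, y2 t)))
  by (intros t; unfold u1, y1, u2, y2; now destruct (c t) as [[? ?] [? ?]]).
assert (P : forall t, interval a b t -> 0 < u1 t /\ 0 < u2 t)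
  by (intros t Ht; specialize (Hpos t Ht); now rewrite Ec in Hpos).
assert (D : forall t, interval a b t ->
  (is_derive u1 t (bA t / u2 t * (u1 t - 1)) /\
   is_derive y1 t (- bA t * (y1 t / (u1 t * u2 t)) + bB t)) /\
  (is_derive u2 t (bA t * (u2 t - 1)) /\
   is_derive y2 t (bA t / u2 t * ((u1 t - 1) / u1 t * y1 t - y2 t) + bB t))).
{ intros t Ht; specialize (Hc t Ht); rewrite (Ec t) in Hc.
  now apply is_derive_phase in Hc. }
assert (Ed : forall (f : R -> R) (t l m : R), is_derive f t l -> l = m -> is_derive f t m)
  by (intros; now subst).
assert (Unique : forall (k l : quad) (i j : bool) (f : R -> R),
  qdefined bA bB t0 p a b k -> qdefined bA bB t0 p a b l ->
  (forall t, interval a b t -> is_derive f t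
    (qeval bA bB t0 p k t * f t + qeval bA bB t0 p l t)) ->
  f t0 = qeval bA bB t0 p (QInit i j) t0 ->
  forall t, interval a b t -> f t = qeval bA bB t0 p (QLin k l (QInit i j)) t).
{ intros k l i j f Hk Hl Hf Hf0.
  apply linear_ode_unique with (qeval bA bB t0 p k) (qeval bA bB t0 p l) t0;
    try assumption.
  - now apply qeval_continuous_on.
  - intros t Ht; now apply is_derive_QLin with a b.
  - now rewrite qeval_QLin_init. }
assert (E2 : forall t, interval a b t -> u2 t = qeval bA bB t0 p quad_u2 t).
{ apply Unique; [exact I | exact (conj I I) | | reflexivity].
  intros t Ht; refine (Ed _ _ _ _ (proj1 (proj2 (D t Ht))) _); simpl; ring. }
(* The formula inherits positivity from the curve, so [quad_k1] is defined on all of [(a, b)]. *)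
assert (P2 : forall t, interval a b t -> 0 < qeval bA bB t0 p quad_u2 t)
  by (intros t Ht; rewrite <- E2 by assumption; now apply P).
pose proof (qdefined_k1 bA bB t0 p a b HA HB H0 P2) as K1.
assert (E1 : forall t, interval a b t -> u1 t = qeval bA bB t0 p quad_u1 t).
{ apply Unique; [exact K1 | exact (conj I K1) | | reflexivity].
  intros t Ht; refine (Ed _ _ _ _ (proj1 (proj1 (D t Ht))) _).
  change (qeval bA bB t0 p quad_k1 t)
    with (bA t * / qeval bA bB t0 p quad_u2 t).
  change (qeval bA bB t0 p (QOpp quad_k1) t)
    with (-1 * (bA t * / qeval bA bB t0 p quad_u2 t)).
  rewrite <- E2 by assumption; destruct (P t Ht); field; lra. }
assert (Q : forall t, interval a b t -> u_positive (quad_solution bA bB t0 p t)).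
{ intros t Ht; unfold quad_solution, u_positive.
  rewrite <- E1, <- E2 by assumption; now apply P. }
destruct (qdefined_coefficients bA bB t0 p a b HA HB H0 Q) as [_ [_ [M1 N2]]].
assert (F1 : forall t, interval a b t -> y1 t = qeval bA bB t0 p quad_y1 t).
{ apply Unique; [exact M1 | exact I | | reflexivity].
  intros t Ht; refine (Ed _ _ _ _ (proj2 (proj1 (D t Ht))) _).
  change (qeval bA bB t0 p quad_m1 t)
    with (-1 * (bA t * / qeval bA bB t0 p quad_u2 t * / qeval bA bB t0 p quad_u1 t)).
  change (qeval bA bB t0 p QbB t) with (bB t).
  rewrite <- E1, <- E2 by assumption; destruct (P t Ht); field; lra. }
assert (F2 : forall t, interval a b t -> y2 t = qeval bA bB t0 p quad_y2 t).
{ apply Unique; [exact (conj I K1) | exact N2 | | reflexivity].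
  intros t Ht; refine (Ed _ _ _ _ (proj2 (proj2 (D t Ht))) _).
  change (qeval bA bB t0 p (QOpp quad_k1) t)
    with (-1 * (bA t * / qeval bA bB t0 p quad_u2 t)).
  change (qeval bA bB t0 p quad_n2 t)
    with (bA t * / qeval bA bB t0 p quad_u2 t
      * ((qeval bA bB t0 p quad_u1 t + -1) * / qeval bA bB t0 p quad_u1 t
         * qeval bA bB t0 p quad_y1 t) + bB t).
  rewrite <- E1, <- E2, <- F1 by assumption; destruct (P t Ht); field; lra. }
intros t Ht; unfold quad_solution.
rewrite <- E1, <- E2, <- F1, <- F2 by assumption; apply Ec.
Qed.

(** * Local existence and solvability by quadratures *)

Lemma interval_weaken (a b a' b' : Rbar) (t : R) :
  Rbar_le a a' -> Rbar_le b' b -> interval a' b' t -> interval a b t.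
Proof.
intros Ha Hb [H1 H2]; split.
- now apply Rbar_le_lt_trans with a'.
- now apply Rbar_lt_le_trans with b'.
Qed.

Lemma positive_on_subinterval (a b : Rbar) (f : R -> R) (t0 : R) :
  continuous f t0 -> interval a b t0 -> 0 < f t0 ->
  exists a' b' : Rbar, interval a' b' t0 /\ Rbar_le a a' /\ Rbar_le b' b /\
    forall t, interval a' b' t -> 0 < f t.
Proof.
intros Hf H0 Hp.
assert (L : locally t0 (fun t => 0 < f t)) by now apply Hf, open_gt.
destruct (filter_and _ _ (interval_locally a b t0 H0) L) as [d Hd].
assert (Hd' : forall t, Rabs (t - t0) < d -> interval a b t /\ 0 < f t)
  by (intros t Ht; now apply Hd).
pose proof (cond_pos d) as Hd0.
(* Half the radius puts the endpoints inside the ball, hence inside [(a, b)], which gives the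
   comparison of endpoints. *)
exists (Finite (t0 - d / 2)), (Finite (t0 + d / 2)).
split; [split; simpl; lra | split; [| split]].
- apply Rbar_lt_le, (Hd' (t0 - d / 2)); apply Rabs_def1; lra.
- apply Rbar_lt_le, (Hd' (t0 + d / 2)); apply Rabs_def1; lra.
- intros t [H1 H2]; simpl in H1, H2.
  apply (Hd' t); apply Rabs_def1; lra.
Qed.

(** On a given interval, uniqueness gives one direction and differentiation of the formulas the
    other. For local existence the interval is shrunk twice, because the formula for u1 makes sense
    only where the one for u2 is non-zero. *)
Lemma transformed_solvable : solvable_by_quadratures transformed_field u_positive.
Proof.
exists quad_u1, quad_y1, quad_u2, quad_y2.
intros bA bB a b t0 H0 Hcont defined formula.
change formula with (quad_solution bA bB t0).
change defined with (fun a' b' p => quad_solution_defined bA bB t0 p a' b').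
clear formula defined; cbv beta.
assert (HA : continuous_on a b bA) by (intros t Ht; now apply Hcont).
assert (HB : continuous_on a b bB) by (intros t Ht; now apply Hcont).
split.
- intros c Hpos; split.
  + intros Hc.
    pose proof (solves_eq_quad_solution bA bB t0 a b c HA HB H0 Hpos Hc) as E.
    split; [|exact E].
    apply (qdefined_coefficients bA bB t0 (c t0) a b HA HB H0).
    intros t Ht; rewrite <- E by assumption; now apply Hpos.
  + intros [_ E] t Ht.
    rewrite (E t Ht).
    (* The curve agrees with the formula only on [(a, b)], which is open and therefore contains a
       neighbourhood of [t]. *)
    refine (is_derive_ext_loc _ _ _ _ _
      (quad_solution_solves bA bB t0 (c t0) a b HA HB H0 _ t Ht)).
    * refine (filter_imp _ _ _ (interval_locally a b t Ht)).
      intros s Hs; symmetry; now apply E.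
    * intros s Hs; rewrite <- E by assumption; now apply Hpos.
- intros p Hp.
  (* Positivity of the initial point is read as positivity of the formulas at [t0]. *)
  rewrite <- (quad_solution_init bA bB t0 p) in Hp; destruct Hp as [Hp1 Hp2].
  pose proof (qdefined_u2 bA bB t0 p a b HA HB H0) as U2.
  destruct (positive_on_subinterval a b (qeval bA bB t0 p quad_u2) t0)
    as [a1 [b1 [I1 [La1 [Lb1 P2]]]]]; try assumption.
  { now apply (qeval_continuous_on bA bB t0 p a b). }
  assert (HA1 : continuous_on a1 b1 bA)
    by (intros t Ht; now apply HA, (interval_weaken a b a1 b1)).
  assert (HB1 : continuous_on a1 b1 bB)
    by (intros t Ht; now apply HB, (interval_weaken a b a1 b1)).
  pose proof (qdefined_u1 bA bB t0 p a1 b1 HA1 HB1 I1 P2) as U1.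
  (* Second shrinking: continuity of the formula for u1 is available on [(a1, b1)], where u2 is
     positive. *)
  destruct (positive_on_subinterval a1 b1 (qeval bA bB t0 p quad_u1) t0)
    as [a2 [b2 [I2 [La2 [Lb2 P1]]]]]; try assumption.
  { now apply (qeval_continuous_on bA bB t0 p a1 b1). }
  assert (HA2 : continuous_on a2 b2 bA)
    by (intros t Ht; now apply HA1, (interval_weaken a1 b1 a2 b2)).
  assert (HB2 : continuous_on a2 b2 bB)
    by (intros t Ht; now apply HB1, (interval_weaken a1 b1 a2 b2)).
  assert (Q : forall t, interval a2 b2 t -> u_positive (quad_solution bA bB t0 p t)).
  { intros t Ht; split; [now apply P1 | now apply P2, (interval_weaken a1 b1 a2 b2)]. }
  exists a2, b2.
  split; [exact I2 | split; [now apply Rbar_le_trans with a1 |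
    split; [now apply Rbar_le_trans with b1 | split; [| split; [| split]]]]].
  + now apply qdefined_coefficients.
  + apply quad_solution_init.
  + exact Q.
  + now apply quad_solution_solves.
Qed.

Theorem mainTheorem8 (bA bB : R -> R) :
  (forall z : R, z <> 0 -> forall (t : R) (p : phase),
     filterdiff (deformed_hamiltonian bA bB z t) (locally p)
       (omega (deformed_field bA bB z t p)) /\
     hamilton_field (deformed_hamiltonian bA bB z t) p
       = deformed_field bA bB z t p) /\
  (forall (t : R) (p : phase),
     filterlim (fun z : R => deformed_field bA bB z t p) (locally' (0 : R))
       (locally (two_copies (undeformed_field1 bA bB t) p))) /\
  (forall z : R, z <> 0 -> forall t : R, bA t <> 0 ->
     ~ (forall p : phase,
          deformed_field bA bB z t p = two_copies (deformed_field1 bA bB z t) p) /\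
     ~ uncoupled (deformed_field bA bB z t)) /\
  (forall z : R, z <> 0 ->
     (forall p : phase, exists! q : phase, u_positive q /\ x_of_u z q = p) /\
     (forall (a b : Rbar) (c : R -> phase),
        (forall t : R, interval a b t -> u_positive (c t)) ->
        (solves (deformed_field bA bB z) a b (fun t => x_of_u z (c t)) <->
         solves (transformed_field bA bB) a b c))) /\
  successively_linear (transformed_field bA bB) /\
  solvable_by_quadratures transformed_field u_positive.
Proof.
split; [|split; [|split; [|split; [|split]]]].
- intros z Hz t p; split.
  + now apply deformed_hamiltonian_filterdiff.
  + now apply hamilton_field_deformed.
- apply deformed_field_limit.
- intros z Hz t HA.
  pose proof (deformed_field_coupled bA bB z t Hz HA) as Hc.
  split; [|exact Hc].
  (* Two copies of a planar field would be uncoupled. *)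
  intros H; apply Hc, (uncoupled_ext _ _ H), uncoupled_two_copies.
- intros z Hz; split.
  + intros p; now apply x_of_u_bijective.
  + intros a b c; now apply change_of_variables.
- apply transformed_successively_linear.
- apply transformed_solvable.
Qed.
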